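(* Let $N\geq 1$, let $A,B,S\in M_N(\mathbb{C})$ with $S$ invertible and $A=SBS^{-1}$, and let $0<\epsilon<1$. If $\kappa(S)^2\epsilon<1$, then $$\sigma_\epsilon(A)\subseteq \sigma_{\kappa(S)^2\epsilon}(B).$$
   Context: $M_N(\mathbb{C})$ is the algebra of complex $N\times N$ matrices; $\|\cdot\|$ is the Euclidean norm on $\mathbb{C}^N$ and the induced operator norm (spectral norm) on $M_N(\mathbb{C})$. For a scalar $z$, $z-A$ means $zI-A$. For $0<\epsilon<1$ the $\epsilon$-condition spectrum of $A$ is $$\sigma_\epsilon(A)=\{z\in\mathbb{C}: z-A \text{ is not invertible, or } \|(z-A)^{-1}\|\,\|z-A\|\geq 1/\epsilon\}.$$ For invertible $S$, $\kappa(S)=\|S\|\,\|S^{-1}\|$ is its condition number. *)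

(* Defs.v *)
From mathcomp Require Import all_boot all_order all_algebra.
From mathcomp Require Import complex.
From mathcomp Require Import classical_sets reals.

Set Implicit Arguments.
Unset Strict Implicit.
Unset Printing Implicit Defensive.

Import Order.TTheory GRing.Theory Num.Theory.
Import Normc.

Local Open Scope classical_set_scope.
Local Open Scope ring_scope.

(* The complex numbers are R[i] for R : realType; [normc] is the modulus with
   values in R (the generic norm on R[i] takes its values in R[i]). *)

Definition enorm (R : realType) (n : nat) (v : 'cV[R[i]]_n) : R :=
  Num.sqrt (\sum_(j < n) normc (v j ord0) ^+ 2).

Definition opnorm (R : realType) (n : nat) (M : 'M[R[i]]_n) : R :=
  sup [set enorm (M *m v) | v in [set v : 'cV[R[i]]_n | enorm v <= 1]].

(* [invmx M] is the inverse only for M \in unitmx (it is M otherwise). *)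
Definition condition_number (R : realType) (n : nat) (S : 'M[R[i]]_n) : R :=
  opnorm S * opnorm (invmx S).

Definition condition_spectrum (R : realType) (n : nat) (eps : R)
    (A : 'M[R[i]]_n) : set R[i] :=
  [set z : R[i] | z%:M - A \notin unitmx \/
     opnorm (invmx (z%:M - A)) * opnorm (z%:M - A) >= 1 / eps].

(* Main.v *)
Require Import Defs.
From mathcomp Require Import all_boot all_order all_algebra.
From mathcomp Require Import complex.
From mathcomp Require Import classical_sets reals.

Set Implicit Arguments.
Unset Strict Implicit.
Unset Printing Implicit Defensive.

Import Order.TTheory GRing.Theory Num.Theory.
Import Normc.

Local Open Scope classical_set_scope.
Local Open Scope ring_scope.

(** Since scalars commute with [S], [z - A = S (z - B) S^-1]. Hence [z - A] and [z - B] are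
    invertible together, and then their inverses are conjugate by [S] too. Submultiplicativity lets
    conjugation enlarge an operator norm by at most the factor [condition_number S]
    ([opnorm_conj_le]). Applied to both [z - B] and its inverse, this costs the square of that
    factor, which is then absorbed into [eps]. The analytic work is to derive submultiplicativity
    ([opnormM]) from the definition of the norm as a supremum. *)

Lemma normc_ge0 (R : rcfType) (x : R[i]) : 0 <= normc x.
Proof. by case: x => a b; apply: sqrtr_ge0. Qed.

Lemma normc_real (R : rcfType) (r : R) : 0 <= r -> normc r%:C%C = r.
Proof. by move=> r0; rewrite /normc /= expr0n addr0 sqrtr_sqr ger0_norm. Qed.

Lemma normc_sum (R : rcfType) (I : finType) (F : I -> R[i]) :
  normc (\sum_i F i) <= \sum_i normc (F i).
Proof.
elim/big_ind2: _ => [|x r y s hx hy|//]; first by rewrite normc0.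
apply: le_trans (lerD hx hy); exact: le_normcD.
Qed.

Section EuclideanNorm.
Variables (R : realType) (n : nat).
Implicit Types (v : 'cV[R[i]]_n) (c : R[i]).

Lemma enorm_ge0 v : 0 <= enorm v.
Proof. exact: sqrtr_ge0. Qed.

Lemma enorm0 : enorm (0 : 'cV[R[i]]_n) = 0.
Proof.
rewrite /enorm big1 ?sqrtr0 // => j _.
by rewrite mxE normc0 expr0n.
Qed.

Lemma enormZ c v : enorm (c *: v) = normc c * enorm v.
Proof.
rewrite /enorm (eq_bigr (fun j => normc c ^+ 2 * normc (v j ord0) ^+ 2)).
  by rewrite -mulr_sumr sqrtrM ?sqr_ge0 // sqrtr_sqr ger0_norm ?normc_ge0.
by move=> j _; rewrite mxE normcM exprMn.
Qed.

Lemma normc_le_enorm v j : normc (v j ord0) <= enorm v.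
Proof.
rewrite -[leLHS]ger0_norm ?normc_ge0 // -sqrtr_sqr; apply: ler_wsqrtr.
by rewrite (bigD1 j) //= lerDl sumr_ge0 // => i _; rewrite sqr_ge0.
Qed.

Lemma enorm_eq0 v : enorm v = 0 -> v = 0.
Proof.
move=> v0; apply/matrixP => j k; rewrite ord1 mxE.
apply: eq0_normc; apply/eqP; rewrite eq_le normc_ge0 andbT -v0.
exact: normc_le_enorm.
Qed.

End EuclideanNorm.

Section OperatorNorm.
Variables (R : realType) (n : nat).
Implicit Types (M K S X : 'M[R[i]]_n) (v : 'cV[R[i]]_n).

(** [sup] is a least upper bound only for a nonempty bounded set, so every estimate on [opnorm]
    rests on this fact. *)
Lemma opnorm_has_sup M :
  has_sup [set enorm (M *m v) | v in [set v : 'cV[R[i]]_n | enorm v <= 1]].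
Proof.
split; first by exists (enorm (M *m 0)), 0 => //=; rewrite enorm0.
(* Coordinates of a vector in the unit ball have modulus at most 1, so each entry of [M *m v] is
   bounded by the sum of the moduli along its row. *)
exists (Num.sqrt (\sum_i (\sum_j normc (M i j)) ^+ 2)) => _ [v /= v1 <-].
apply: ler_wsqrtr; apply: ler_sum => i _.
rewrite lerXn2r ?nnegrE ?normc_ge0 ?sumr_ge0 // => [j _|]; first exact: normc_ge0.
rewrite mxE; apply: le_trans (normc_sum _) _; apply: ler_sum => j _.
rewrite normcM ler_piMr ?normc_ge0 //.
exact: le_trans (normc_le_enorm v j) v1.
Qed.

Lemma opnorm_ge0 M : 0 <= opnorm M.
Proof.
have /ubP ub := sup_upper_bound (opnorm_has_sup M).
by apply: ub; exists 0 => /=; rewrite ?mulmx0 enorm0.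
Qed.

Lemma enorm_mulmx_le M v : enorm (M *m v) <= opnorm M * enorm v.
Proof.
have [/enorm_eq0 ->|v0] := eqVneq (enorm v) 0.
  by rewrite mulmx0 enorm0 mulr0.
have vgt0 : 0 < enorm v by rewrite lt_def v0 enorm_ge0.
have normcr : normc ((enorm v)^-1)%:C%C = (enorm v)^-1.
  by rewrite normc_real // invr_ge0 enorm_ge0.
have /ubP ub := sup_upper_bound (opnorm_has_sup M).
(* Dividing by [enorm v] amounts to applying [M] to the normalized vector, which lies in the unit
   ball. *)
rewrite -ler_pdivrMr // mulrC -normcr -enormZ scalemxAr; apply: ub.
by exists (((enorm v)^-1)%:C%C *: v) => //=; rewrite enormZ normcr mulVf.
Qed.

Lemma opnormM M K : opnorm (M *m K) <= opnorm M * opnorm K.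
Proof.
apply: ge_sup => [|_ [v /= v1 <-]]; first by have [] := opnorm_has_sup (M *m K).
rewrite -mulmxA; apply: le_trans (enorm_mulmx_le _ _) _.
rewrite ler_wpM2l ?opnorm_ge0 //; apply: le_trans (enorm_mulmx_le _ _) _.
by rewrite ler_piMr ?opnorm_ge0.
Qed.

Lemma opnorm_conj_le S X :
  opnorm (S *m X *m invmx S) <= condition_number S * opnorm X.
Proof.
rewrite /condition_number mulrAC; apply: le_trans (opnormM _ _) _.
by rewrite ler_wpM2r ?opnorm_ge0 // opnormM.
Qed.

End OperatorNorm.

Lemma invmx_conj (F : comUnitRingType) (n : nat) (S X : 'M[F]_n) :
  S \in unitmx -> X \in unitmx ->
  invmx (S *m X *m invmx S) = S *m invmx X *m invmx S.
Proof.
move=> hS hX; have hC : S *m X *m invmx S \in unitmx.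
  by rewrite !unitmx_mul unitmx_inv hS hX.
(* Left multiplication by a unit is injective, so it suffices that both sides are right inverses of
   the conjugate. *)
apply: (can_inj (mulKmx hC)).
by rewrite mulmxV // !mulmxA mulmxKV // mulmxK // mulmxV.
Qed.

Lemma scalar_sub_conj (F : comUnitRingType) (n : nat) (S B : 'M[F]_n) (z : F) :
  S \in unitmx -> z%:M - S *m B *m invmx S = S *m (z%:M - B) *m invmx S.
Proof.
by move=> hS; rewrite mulmxBr mulmxBl scalar_mxC mulmxK.
Qed.

Theorem mainTheorem3 (R : realType) (N : nat) (A B S : 'M[R[i]]_N) (eps : R)
    (hN : (1 <= N)%N)
    (hS : S \in unitmx)
    (hA : A = S *m B *m invmx S)
    (heps0 : 0 < eps) (heps1 : eps < 1)
    (hkappa : condition_number S ^+ 2 * eps < 1) :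
  condition_spectrum eps A `<=`
    condition_spectrum (condition_number S ^+ 2 * eps) B.
Proof.
move=> z; rewrite /condition_spectrum /= hA (scalar_sub_conj _ _ hS).
move: (z%:M - B) => X hz.
have [hX|] := boolP (X \in unitmx); last by left.
(* Conjugation by [S] preserves invertibility, so only the norm alternative remains for [z - A]. *)
right; case: hz; first by rewrite !unitmx_mul unitmx_inv hS hX.
rewrite (invmx_conj hS hX) => hz.
set k := condition_number S in hkappa *.
set K := opnorm (invmx X) * opnorm X.
have K0 : 0 <= K by rewrite mulr_ge0 ?opnorm_ge0.
have hK : 1 / eps <= k ^+ 2 * K.
  (* One factor [k] goes to each of the two norms in [K]. *)
  apply: le_trans hz _; rewrite expr2 mulrACA.
  by apply: ler_pM; rewrite ?opnorm_ge0 ?opnorm_conj_le.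
(* If [k ^+ 2] vanished, [hK] would bound the positive number [1 / eps] by 0. *)
have k2gt0 : 0 < k ^+ 2.
  rewrite lt_def sqr_ge0 andbT; apply: contraTneq hK => ->.
  by rewrite mul0r -ltNge divr_gt0.
have keps : 0 < k ^+ 2 * eps := mulr_gt0 k2gt0 heps0.
by rewrite (ler_pdivrMr _ _ keps) mulrA [K * _]mulrC -ler_pdivrMr.
Qed.
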